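(* If $G$ is a unicyclic graph of order $n\ge 3$, then $N(G)\ge \frac{n^2+3n-4}{2}$, with equality if and only if $G$ is isomorphic to the tadpole graph $G_{3,n-3}$.
   Context: A unicyclic graph is a connected finite simple graph containing exactly one cycle. $N(G)$ denotes the number of nonempty vertex sets $S\subseteq V(G)$ such that the induced subgraph $G[S]$ is connected. The tadpole graph $G_{p,q}$ is the graph of order $p+q$ obtained by identifying a vertex of the cycle $C_p$ with an endpoint of the path on $q+1$ vertices; in particular $G_{3,n-3}$ is obtained by identifying a vertex of a triangle $K_3$ with an endpoint of the path on $n-2$ vertices. *)

(* Defs.v *)
From mathcomp Require Import all_boot.
Set Implicit Arguments. Unset Strict Implicit. Unset Printing Implicit Defensive.

Definition simple_graph (T : finType) (e : rel T) : Prop :=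
  symmetric e /\ irreflexive e.

Definition induced_rel (T : finType) (e : rel T) (S : {set T}) : rel T :=
  [rel x y | [&& x \in S, y \in S & e x y]].

Definition induced_connected (T : finType) (e : rel T) (S : {set T}) : bool :=
  (S != set0) && [forall x in S, forall y in S, connect (induced_rel e S) x y].

Definition Nconn (T : finType) (e : rel T) : nat :=
  #|[set S : {set T} | induced_connected e S]|.

Definition connected_graph (T : finType) (e : rel T) : bool :=
  induced_connected e [set: T].

(* An edge {x,y} is represented as the 2-element set [set x; y]. A cycle of G
   is identified with its edge set: the edges {v_i, v_(i+1 mod k)} of a cyclic
   sequence of k >= 3 distinct vertices, consecutive ones adjacent. *)
Definition is_cycle (T : finType) (e : rel T) (C : {set {set T}}) : Prop :=
  exists s : seq T,
    [/\ uniq s, 3 <= size s, cycle e s &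
        C = [set [set x; next s x] | x in s]].

Definition unicyclic (T : finType) (e : rel T) : Prop :=
  [/\ simple_graph e, connected_graph e &
      exists C, is_cycle e C /\ forall C', is_cycle e C' -> C' = C].

Definition tadpole3 (n : nat) : rel 'I_n :=
  fun x y =>
    [|| [&& (x < 3)%N, (y < 3)%N & x != y],
        ((2 <= x)%N && (x.+1 == y :> nat))
      | ((2 <= y)%N && (y.+1 == x :> nat))].

Definition graph_iso (T U : finType) (e : rel T) (f : rel U) : Prop :=
  exists g : T -> U, bijective g /\ forall x y, e x y = f (g x) (g y).
Arguments tadpole3 n : clear implicits.

(* Main.v *)
Require Import Defs.
From mathcomp Require Import all_boot zify.

(** For every pair of (possibly equal) vertices, a shortest path between them is
    an induced path, and the pair is recovered from its vertex set as the
    vertices with at most one neighbour inside it.  This gives n + C(n,2)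
    connected sets, none of which contains a cycle.  Fix an induced cycle C with
    p vertices: growing C one vertex at a time gives n - p + 1 further connected
    sets.  For p = 3 this is the bound.  For p >= 4 each of p - 2 pairs of
    vertices at distance two along C is joined by two induced paths around C, and
    the bound is strict.  In the case of equality p = 3, there is exactly one
    connected set of each size containing C, and a connected set not containing C
    is not a triangle; so the vertices outside C are attached one after the other,
    each to the previous one only. *)

Set Implicit Arguments. Unset Strict Implicit. Unset Printing Implicit Defensive.

(** * Growing and gluing connected vertex sets *)

Section Connectivity.
Variables (T : finType) (e : rel T).
Hypotheses (sym_e : symmetric e).
Implicit Types (S A B : {set T}) (x y : T).

Lemma induced_relE S x y :
  induced_rel e S x y = [&& x \in S, y \in S & e x y].
Proof. by []. Qed.

Lemma induced_connected_from x S :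
  x \in S -> {in S, forall y, connect (induced_rel e S) x y} ->
  induced_connected e S.
Proof.
move=> xS conx; apply/andP; split; first by apply/set0Pn; exists x.
have csym : connect_sym (induced_rel e S).
  by apply: sym_connect_sym => a b; rewrite !induced_relE sym_e andbCA.
apply/forall_inP => a aS; apply/forall_inP => b bS.
by apply: connect_trans (conx _ bS); rewrite csym; apply: conx.
Qed.

Lemma induced_connectedP S :
  induced_connected e S -> {in S &, forall x y, connect (induced_rel e S) x y}.
Proof. by case/andP=> _ /forall_inP cS x y /cS/forall_inP; apply. Qed.

Lemma connect_induced_sub A B x y : A \subset B ->
  connect (induced_rel e A) x y -> connect (induced_rel e B) x y.
Proof.
move=> /subsetP sAB; apply: connect_sub => a b /and3P[aA bA eab].
by apply: connect1; rewrite induced_relE !sAB.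
Qed.

Lemma induced_connectedU A B x y : induced_connected e A ->
  induced_connected e B -> x \in A -> y \in B -> e x y ->
  induced_connected e (A :|: B).
Proof.
move=> /induced_connectedP cA /induced_connectedP cB xA yB exy.
apply: (@induced_connected_from x); first by rewrite inE xA.
move=> z; rewrite inE => /orP[zA | zB].
  by apply: connect_induced_sub (cA _ _ xA zA); apply: subsetUl.
apply: connect_trans (connect_induced_sub (subsetUr _ _) (cB _ _ yB zB)).
by apply: connect1; rewrite induced_relE !inE xA yB orbT.
Qed.

Lemma induced_connected1 x : induced_connected e [set x].
Proof.
by apply: (@induced_connected_from x); rewrite ?set11 // => y /set1P->.
Qed.

Lemma induced_connectedU1 A x y : induced_connected e A ->
  y \in A -> e x y -> induced_connected e (x |: A).
Proof.
move=> cA yA; apply: induced_connectedU => //; last exact: set11.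
exact: induced_connected1.
Qed.

Lemma induced_connected_path x p : path e x p ->
  induced_connected e [set z in x :: p].
Proof.
elim: p x => [|y p IHp] x /=.
  rewrite (_ : [set z in _] = [set x]) ?induced_connected1 //.
  by apply/setP => z; rewrite !inE.
case/andP=> exy /IHp cp.
rewrite (_ : [set z in _] = x |: [set z in y :: p]).
  by apply: induced_connectedU1 cp _ exy; rewrite !inE eqxx.
by apply/setP => z; rewrite !inE.
Qed.

(** A walk inside [B] from a vertex of [A] to a vertex outside [A] has a first step that leaves
    [A]. *)
Lemma induced_connected_edge_out A B : induced_connected e B ->
  A \proper B -> A != set0 ->
  exists x y, [/\ x \in A, y \in B, y \notin A & e x y].
Proof.
move=> /induced_connectedP cB /properP[/subsetP sAB [y yB yA]] /set0Pn[x xA].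
case/connectP: (cB _ _ (sAB _ xA) yB) => p; elim: p x xA => [|z p IHp] x xA /=.
  by move=> _ yx; rewrite yx xA in yA.
case/andP=> /and3P[_ zB exz] ep yE.
case: (boolP (z \in A)) => zA; first exact: IHp zA ep yE.
by exists x, z.
Qed.

(** As long as the set is not everything, an edge leaves it; adding the far end of that edge raises
    the size by exactly one. *)
Lemma induced_connected_superset A k : connected_graph e ->
  induced_connected e A -> #|A| <= k <= #|T| ->
  exists B, [/\ induced_connected e B, A \subset B & #|B| = k].
Proof.
move=> cT cA /andP[leAk]; elim: k leAk => [|k IHk] leAk ltk.
  by exists A; split=> //; apply/eqP; rewrite -leqn0.
case: (ltngtP #|A| k.+1) leAk => // [ltAk|eqAk] _; last by exists A.
have [B [cB sAB cardB]] := IHk ltAk (ltnW ltk).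
have: B \proper [set: T] by rewrite properEcard subsetT cardsT cardB.
case/(induced_connected_edge_out cT) => [|x [y [xB _ yB exy]]].
  by case/andP: cB.
exists (y |: B); split; first by apply: induced_connectedU1 cB xB _; rewrite sym_e.
  by apply: subset_trans sAB _; apply: subsetUr.
by rewrite cardsU1 yB cardB.
Qed.

End Connectivity.

(** * Induced paths and their ends *)

Definition induced_path (T : finType) (e : rel T) (s : seq T) :=
  uniq s /\ forall x0 i j, i < size s -> j < size s ->
    e (nth x0 s i) (nth x0 s j) = (i.+1 == j) || (j.+1 == i).

(** Defined from the set alone, so that the pair of endpoints of an induced path can be recovered
    without knowing the path as a sequence. *)
Definition ends (T : finType) (e : rel T) (S : {set T}) :=
  [set x in S | #|[set y in S | e x y]| <= 1].

Section InducedPaths.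
Variables (T : finType) (e : rel T).
Hypotheses (sym_e : symmetric e) (irr_e : irreflexive e).

(** A shortest path has no chord, since a chord would give a shortcut. *)
Lemma exists_induced_path x y : connect e x y ->
  exists p, [/\ path e x p, last x p = y & induced_path e (x :: p)].
Proof.
move=> cxy.
pose P n := [exists p : n.-tuple T, path e x p && (last x p == y)].
have exP : exists n, P n.
  case/connectP: cxy => p ep yE; exists (size p).
  by apply/existsP; exists (in_tuple p); rewrite ep yE eqxx.
case: (ex_minnP exP) => n /existsP[[p0 /= /eqP sz0]] /andP[ep0 /eqP yE] minn.
(* Removing repetitions from a shortest walk keeps it shortest and makes it duplicate-free. *)
have [p [ep lp up minp]] : exists p, [/\ path e x p, last x p = y, uniq (x :: p)
    & forall q, path e x q -> last x q = y -> size p <= size q].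
  move: yE; case: (shortenP ep0) => p ep up sp yE; exists p; split=> // q eq lq.
  apply: (@leq_trans n).
    rewrite -sz0; apply: uniq_leq_size => //; by case/andP: up.
  by apply: minn; apply/existsP; exists (in_tuple q); rewrite eq lq eqxx.
exists p; split=> //; split=> // x0.
have main i j : i < j -> j < size (x :: p) ->
    e (nth x0 (x :: p) i) (nth x0 (x :: p) j) = (i.+1 == j).
  case: j => // j; rewrite ltnS /= ltnS => leij ltj.
  have pi : nth x0 (x :: p) i = last x (take i p).
    rewrite (last_nth x0) size_takel ?(leq_trans leij (ltnW ltj)) //.
    by case: (i) => //= k; rewrite nth_take.
  have dj : drop j p = nth x0 p j :: drop j.+1 p by rewrite (drop_nth x0).
  apply/idP/eqP => [eij | [eij]]; last first.
    rewrite pi eij; move: ep; rewrite -{1}(cat_take_drop j p) cat_path dj /=.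
    by case/and3P.
  (* The shortcut through the chord: its length [i + (size p - j)] is at least [size p] only if
     [i = j], where [j] is now the position in [p], one less than in [x :: p]. *)
  have := minp (take i p ++ drop j p); rewrite cat_path last_cat -pi.
  rewrite {1 2}dj /= eij size_cat size_drop size_takel; last by lia.
  have -> : path e x (take i p).
    by move: ep; rewrite -{1}(cat_take_drop i p) cat_path => /andP[].
  have -> : path e (nth x0 p j) (drop j.+1 p).
    by move: ep; rewrite -{1}(cat_take_drop j p) cat_path dj /= => /and3P[].
  have -> : last (nth x0 p j) (drop j.+1 p) = y.
    by rewrite -lp -[in RHS](cat_take_drop j p) last_cat dj.
  by move=> /(_ isT erefl); lia.
move=> i j ilt jlt; case: (ltngtP i j) => [ij | ji | ->].
- by rewrite main //; lia.
- by rewrite sym_e main //; lia.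
- by rewrite irr_e; lia.
Qed.

Lemma ends_induced_path x p : induced_path e (x :: p) ->
  ends e [set z in x :: p] = [set x; last x p].
Proof.
case=> up ip; set s := x :: p in up ip *; have s_gt0 : 0 < size s by [].
have lE : last x p = nth x s (size p) by rewrite (last_nth x).
apply/setP => z; rewrite in_set in_set2 in_set.
case: (boolP (z \in s)) => [/(nthP x)[i ilt <-] | zs] /=; last first.
  apply/esym/negbTE; apply: contra zs => /orP[] /eqP->; last by rewrite mem_last.
  exact: mem_head.
rewrite lE nth_uniq // -[_ == x]/(nth x s i == nth x s 0) nth_uniq //.
case: (boolP ((i == 0) || (i == size p))) => [i_end | i_mid].
  suff [y sub]: exists y, [set y in [set z in s] | e (nth x s i) y] \subset [set y].
    by apply: leq_trans (subset_leq_card sub) _; rewrite cards1.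
  (* The only possible neighbour of an end. On a one-vertex path, position 1 gives the default [x],
     which is harmless since there is no neighbour at all. *)
  exists (nth x s (if i == 0 then 1 else i.-1)); apply/subsetP => y.
  rewrite in_set in_set1 in_set => /andP[/(nthP x)[j jlt <-]]; rewrite ip // => ij.
  apply/eqP; congr (nth _ _ _); rewrite /= in ilt jlt; case: eqP i_end ij; lia.
have i1 : i.-1 < size s := leq_ltn_trans (leq_pred i) ilt.
have i2 : i.+1 < size s by move: ilt i_mid; rewrite /s /=; lia.
apply/negbTE; rewrite -ltnNge.
have sub : [set nth x s i.-1; nth x s i.+1] \subset
    [set y in [set z in s] | e (nth x s i) y].
  apply/subsetP => y; rewrite in_set2 in_set in_set.
  by case/orP => /eqP->; rewrite mem_nth // ip //; lia.
apply: leq_trans (subset_leq_card sub).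
by rewrite cards2 nth_uniq //; lia.
Qed.

(** The vertex of [C] that comes last along the path has at most its predecessor as a neighbour in
    [C]. *)
Lemma induced_path_acyclic s (C : {set T}) : induced_path e s ->
  C \subset [set z in s] ->
  {in C, forall x, 1 < #|[set y in C | e x y]|} -> C = set0.
Proof.
move=> [us ip] /subsetP sCs degC; apply/eqP/negPn/negP => /set0Pn[c cC].
case: (arg_maxnP (fun x => index x s) cC) => x xC maxx.
have xs : x \in s by have := sCs _ xC; rewrite inE.
have := degC x xC; rewrite ltnNge => /negP; apply.
suff sub : [set y in C | e x y] \subset [set nth x s (index x s).-1].
  by apply: leq_trans (subset_leq_card sub) _; rewrite cards1.
apply/subsetP => y; rewrite !inE => /andP[yC].
have ys : y \in s by have := sCs _ yC; rewrite inE.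
rewrite -{1}(nth_index x xs) -{1}(nth_index x ys) ip ?index_mem // => xy.
have := maxx y yC; rewrite /= -{2}(nth_index x ys) => yx.
by rewrite nth_uniq ?index_mem ?prednK //; move: (xs); rewrite -index_mem; lia.
Qed.

End InducedPaths.

(** * Induced cycles and their arcs *)

Definition induced_cycle (T : finType) (e : rel T) (s : seq T) :=
  [/\ uniq s, 2 < size s & forall x0 i j, i < size s -> j < size s ->
    e (nth x0 s i) (nth x0 s j) =
      [|| i.+1 == j, j.+1 == i, (i == 0) && (j.+1 == size s)
        | (j == 0) && (i.+1 == size s)]].

(** The trace of a cycle that the counting relies on: an induced cycle has this property, and no
    nonempty part of an induced path does. *)
Definition deg_ge2 (T : finType) (e : rel T) (C : {set T}) :=
  {in C, forall x, 1 < #|[set y in C | e x y]|}.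

Section InducedCycle.
Variables (T : finType) (e : rel T).
Hypotheses (sym_e : symmetric e) (irr_e : irreflexive e).

(** Delete one edge of the cycle and join its endpoints by a shortest path in what remains; the
    deleted edge closes this path into an induced cycle. *)
Lemma exists_induced_cycle C : is_cycle e C -> exists s, induced_cycle e s.
Proof.
case=> [[|x [|u [|w p]]]] [] // us _ cs _.
set y := last w p.
have eyx : e y x by move: cs; rewrite /= rcons_path => /and4P[].
pose e' : rel T := fun a b =>
  e a b && ~~ ((a == x) && (b == y) || (a == y) && (b == x)).
have sym_e' : symmetric e'.
  by move=> a b; rewrite /e' sym_e; congr (_ && ~~ _);
  rewrite orbC andbC [in X in _ || X]andbC.
have irr_e' : irreflexive e' by move=> a; rewrite /e' irr_e.
have e'E a b : e' a b =
    e a b && ~~ ((a == x) && (b == y) || (a == y) && (b == x)) by [].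
have cxy : connect e' x y.
  apply/connectP; exists [:: u, w & p] => //.
  have /and3P[exu euw ewp] : [&& e x u, e u w & path e w p].
    by move: cs; rewrite /= rcons_path => /and4P[-> -> -> _].
  move: us; rewrite [uniq _]/= !inE !negb_or -!andbA.
  case/and5P=> xu xw xp uw /and3P[up wp unp].
  have yin : y \in w :: p by rewrite mem_last.
  have yx : y != x.
    by apply: contraTneq yin => ->; rewrite inE negb_or xw xp.
  have yu : y != u.
    by apply: contraTneq yin => ->; rewrite inE negb_or uw up.
  (* The rest of the cycle never returns to [x], so it does not use the deleted edge. *)
  have ok : path e' u (w :: p).
    apply: (@sub_in_path _ (predC1 x) e) => [a b ||].
    - by rewrite !inE => ax bx eab; rewrite /e' eab (negbTE ax) (negbTE bx) andbF.
    - rewrite /= eq_sym xu eq_sym xw /=; apply/allP => z zp.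
      by rewrite inE; apply: contraNneq xp => <-.
    - by rewrite /= euw.
  rewrite [path _ _ _]/= -[_ && path _ _ _]/(path e' u (w :: p)) ok andbT.
  by rewrite /e' exu /= eq_sym (negbTE yu) andbF eq_sym (negbTE yx).
have [q [eq lq [uq iq]]] := exists_induced_path sym_e' irr_e' cxy.
have yx : y != x by apply: contraTneq eyx => ->; rewrite irr_e.
(* A path with a single edge would be the deleted edge itself. *)
have sq : 1 < size q.
  case: q eq lq {uq iq} => [|z [|//]] /=; first by move=> _ xy; rewrite xy eqxx in yx.
  by rewrite andbT => /andP[_ /negP nz] zy; case: nz; rewrite zy !eqxx.
exists (x :: q); split=> // x0 i j ilt jlt.
have lE : y = nth x0 (x :: q) (size q) by rewrite -lq (last_nth x0).
have xE k : k < size (x :: q) -> (nth x0 (x :: q) k == x) = (k == 0).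
  by move=> kl; rewrite -[_ == x]/(_ == nth x0 (x :: q) 0) nth_uniq.
have yE k : k < size (x :: q) -> (nth x0 (x :: q) k == y) = (k == size q).
  by move=> kl; rewrite lE nth_uniq.
have := iq x0 i j ilt jlt; rewrite e'E !xE // !yE //.
have [e0 | ne0] := boolP ((i == 0) && (j == size q) || (i == size q) && (j == 0)).
  move=> _; have -> : e (nth x0 (x :: q) i) (nth x0 (x :: q) j).
    by case/orP: e0 => /andP[/eqP-> /eqP->]; rewrite -lE // sym_e.
  by apply/esym; move: e0; rewrite /= in ilt jlt *; lia.
by rewrite andbT => ->; move: ne0; rewrite /= in ilt jlt *; lia.
Qed.

Variable s : seq T.
Hypothesis cs : induced_cycle e s.
Let C := [set z in s].

Lemma induced_cycle_sorted : sorted e s.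
Proof.
case: cs => _ s3 es; case: s s3 es => // x p _ es; apply/(sortedP x) => i lti.
by rewrite es ?eqxx // ltnW.
Qed.

Lemma card_induced_cycle : #|C| = size s.
Proof. by case: cs => us _ _; rewrite cardsE; apply/card_uniqP. Qed.

Lemma induced_connected_sorted (p : seq T) : sorted e p -> p != [::] ->
  induced_connected e [set z in p].
Proof. by case: p => // x p /(induced_connected_path sym_e). Qed.

Lemma induced_cycle_connected : induced_connected e C.
Proof.
apply: induced_connected_sorted induced_cycle_sorted _.
by case: cs => _; case: (s).
Qed.

Lemma induced_cycle_deg_ge2 : deg_ge2 e C.
Proof.
case: cs => us s3 es x; rewrite inE => /(nthP x)[i il <-].
have ilt : i < size s := il.
pose a := if i == 0 then (size s).-1 else i.-1.
pose b := if i.+1 == size s then 0 else i.+1.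
have alt : a < size s by rewrite /a; case: eqP; lia.
have blt : b < size s by rewrite /b; case: eqP; lia.
have sub : [set nth x s a; nth x s b] \subset [set y in C | e (nth x s i) y].
  apply/subsetP => y; rewrite !inE.
  by case/orP => /eqP->; rewrite mem_nth // es // /a /b; case: (i =P 0); case: (i.+1 =P size s); lia.
apply: leq_trans (subset_leq_card sub).
by rewrite cards2 nth_uniq // /a /b; case: (i =P 0); case: (i.+1 =P size s); lia.
Qed.

(** For [i] neither first nor last, both stretches around position [i] are nonempty, and the closing
    edge joins them. *)
Lemma induced_cycle_D1_connected x0 i : 0 < i -> i.+1 < size s ->
  induced_connected e (C :\ nth x0 s i).
Proof.
move=> i0 ilt; have [us s3 es] := cs; have sE := induced_cycle_sorted.
have ile : i <= size s := ltnW (ltnW ilt).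
have -> : C :\ nth x0 s i = [set z in take i s] :|: [set z in drop i.+1 s].
  have sP : s = take i s ++ nth x0 s i :: drop i.+1 s.
    by rewrite -drop_nth ?cat_take_drop // ltnW.
  apply/setP => z; rewrite !inE {2}sP mem_cat inE.
  move: us; rewrite {1}sP cat_uniq /= negb_or => /and4P[_ /andP[nt _] nd _].
  case: (z =P nth x0 s i) => [-> | _] //=.
  by rewrite (negbTE nt) (negbTE nd).
apply: (@induced_connectedU _ _ sym_e _ _ (nth x0 s 0) (nth x0 s (size s).-1)).
- apply: induced_connected_sorted; first exact: take_sorted.
  by rewrite -size_eq0 size_takel // -lt0n.
- apply: induced_connected_sorted; first exact: drop_sorted.
  by rewrite -size_eq0 size_drop subn_eq0 -ltnNge.
- by rewrite inE -(nth_take x0 i0) mem_nth // size_takel.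
- rewrite inE; have -> : (size s).-1 = i.+1 + (size s - i.+2) by lia.
  rewrite -nth_drop mem_nth // size_drop; change (size s - i.+2 < size s - i.+1); lia.
- by rewrite es; lia.
Qed.

(** Each neighbour of the deleted vertex keeps only its other neighbour on the cycle. The inclusion
    is enough: equality will follow by cardinality. *)
Lemma ends_induced_cycle_D1 x0 i : 0 < i -> i.+1 < size s ->
  [set nth x0 s i.-1; nth x0 s i.+1] \subset ends e (C :\ nth x0 s i).
Proof.
move=> i0 ilt; have [us s3 es] := cs.
suff end1 k y : k < size s -> k != i ->
    (forall j, j < size s -> j != i -> e (nth x0 s k) (nth x0 s j) -> nth x0 s j = y) ->
    nth x0 s k \in ends e (C :\ nth x0 s i).
  apply/subsetP => z /set2P[] ->.
    (* The other neighbour of position [i.-1], wrapping around to the last position when [i = 1]. *)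
    apply: (end1 _ (nth x0 s (if i == 1 then (size s).-1 else i.-2))); try lia.
    move=> j jlt ji; rewrite es //; last lia.
    by move=> ej; congr nth; move: ej; case: (i =P 1); lia.
  apply: (end1 _ (nth x0 s (if i.+2 == size s then 0 else i.+2))); try lia.
  move=> j jlt ji; rewrite es //.
  by move=> ej; congr nth; move: ej; case: (i.+2 =P size s); lia.
move=> klt ki nb; rewrite !inE nth_uniq // ?(ltnW ilt) // ki mem_nth //=.
rewrite -(cards1 y); apply/subset_leq_card/subsetP => z; rewrite !inE.
case/andP=> /andP[zi /(nthP x0)[j jlt jz]]; rewrite -jz in zi * => ekj.
by apply/eqP; apply: nb ekj => //; apply: contraNneq zi => ->.
Qed.

End InducedCycle.

(** * Lower bounds for the numbers of connected sets *)

Section Counting.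
Variables (T : finType) (e : rel T).
Hypotheses (sym_e : symmetric e) (irr_e : irreflexive e) (con_e : connected_graph e).
Implicit Types (A C S : {set T}).

(** Sets of size one or two encode the unordered pairs of possibly equal vertices. *)
Lemma card_small_sets :
  #|[set A : {set T} | 0 < #|A| <= 2]| = #|T| + 'C(#|T|, 2).
Proof.
rewrite -{1}(bin1 #|T|) -!card_draws.
rewrite -cardsUI [X in _ = _ + X](_ : _ = 0).
  by rewrite addn0; apply: eq_card => A; rewrite !inE; lia.
by apply/eqP; rewrite cards_eq0; apply/eqP/setP => A; rewrite !inE; lia.
Qed.

Lemma exists_ends A : 0 < #|A| <= 2 -> exists S, [/\ induced_connected e S,
  ends e S = A & forall C, C \subset S -> deg_ge2 e C -> C = set0].
Proof.
move=> cA; have [x [y ->]] : exists x y, A = [set x; y].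
  have [/eqP/cards1P[x ->]|A1] := eqVneq #|A| 1; first by exists x, x; rewrite setUid.
  have /cards2P[x [y [_ ->]]] : #|A| == 2 by lia.
  by exists x, y.
have cxy : connect e x y.
  have /= := induced_connectedP con_e (in_setT x) (in_setT y).
  by apply: connect_sub => a b /and3P[_ _]; apply: connect1.
have [p [ep <- ip]] := exists_induced_path sym_e irr_e cxy.
exists [set z in x :: p]; split; first exact: induced_connected_path.
- exact: ends_induced_path.
- by move=> C sC dC; apply: induced_path_acyclic ip sC dC.
Qed.

(** Stated for an arbitrary family [X], so that it also applies after some sets have been removed,
    which is how the strict bounds arise. *)
Lemma leq_card_ends_onto (X : {set {set T}}) :
  (forall A, 0 < #|A| <= 2 -> exists2 S, S \in X & ends e S = A) ->
  #|T| + 'C(#|T|, 2) <= #|X|.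
Proof.
move=> onto; rewrite -card_small_sets.
apply: leq_trans (leq_imset_card (ends e) X).
apply/subset_leq_card/subsetP => A; rewrite inE => /onto[S SX <-].
exact: imset_f.
Qed.

Lemma leq_card_sizes (Y : {set {set T}}) m :
  (forall k, m <= k <= #|T| -> exists2 S, S \in Y & #|S| = k) ->
  #|T|.+1 - m <= #|Y|.
Proof.
move=> onto; rewrite -(size_iota m (_ - m)) cardE -(size_map (fun S => #|S|)).
apply: uniq_leq_size (iota_uniq _ _) _ => k; rewrite mem_iota => kP.
case: (onto k) => [|S SY <-]; first by lia.
by apply: map_f; rewrite mem_enum.
Qed.

Definition avoiding C := [set S | induced_connected e S & ~~ (C \subset S)].
Definition containing C := [set S | induced_connected e S & C \subset S].

Lemma Nconn_split C : Nconn e = #|containing C| + #|avoiding C|.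
Proof.
rewrite /Nconn -(cardsID [set S : {set T} | C \subset S]).
by congr (_ + _); apply: eq_card => S; rewrite !inE // andbC.
Qed.

Lemma card_containing C : induced_connected e C ->
  #|T|.+1 - #|C| <= #|containing C|.
Proof.
move=> cC; apply: leq_card_sizes => k /(induced_connected_superset sym_e con_e cC).
by case=> S [cS sCS kS]; exists S; rewrite // inE cS.
Qed.

(** If two sets of the same size contained [C], every size would still be represented after removing
    [S2], so the count would exceed the bound. *)
Lemma containing_inj C S1 S2 : induced_connected e C ->
  #|containing C| <= #|T|.+1 - #|C| -> S1 \in containing C ->
  S2 \in containing C -> #|S1| = #|S2| -> S1 = S2.
Proof.
move=> cC le S1C S2C eqS; apply/eqP; apply: contraTT le => neS; rewrite -ltnNge.
rewrite (cardsD1 S2) S2C ltnS; apply: leq_card_sizes => k kP.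
have [->|kS] := eqVneq k #|S1|; first by exists S1; rewrite // in_setD1 neS.
case: (induced_connected_superset sym_e con_e cC kP) => S [cS sCS eqk].
exists S; rewrite // !inE cS sCS !andbT; apply: contraNneq kS => SE.
by rewrite -eqk SE eqS.
Qed.

Lemma card_avoiding C : C != set0 -> deg_ge2 e C ->
  #|T| + 'C(#|T|, 2) <= #|avoiding C|.
Proof.
move=> C0 dC; apply: leq_card_ends_onto => A /exists_ends[S [cS eS aS]].
exists S; rewrite // inE cS; apply: contraNN C0 => sCS.
by rewrite (aS _ sCS dC).
Qed.

(** A set without ends is never the one chosen for a pair, so it would come on top of the bound.
    This will exclude a second triangle. *)
Lemma avoiding_ends_neq0 C S : C != set0 -> deg_ge2 e C ->
  #|avoiding C| <= #|T| + 'C(#|T|, 2) -> S \in avoiding C -> ends e S != set0.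
Proof.
move=> C0 dC le SC; apply: contraTneq le => eS0.
rewrite -ltnNge (cardsD1 S) SC ltnS; apply: leq_card_ends_onto => A cA.
have [S' [cS eS aS]] := exists_ends cA; exists S'; rewrite // !inE cS.
apply/andP; split.
  by apply: contraTneq cA => SE; rewrite -eS SE eS0 cards0.
by apply: contraNN C0 => sCS; rewrite (aS _ sCS dC).
Qed.

(* The two arcs of the cycle between v_(i-1) and v_(i+1) are induced paths with
   the same ends, so the longer ones come on top of one path per pair. *)
Lemma card_avoiding_long s : induced_cycle e s -> 3 < size s ->
  #|T| + 'C(#|T|, 2) + (size s - 2) <= #|avoiding [set z in s]|.
Proof.
move=> cs s4; have [us s3 es] := cs; set C := [set z in s].
have [x0 x0s] : exists x0, x0 \in s by case: (s) s4 => // x *; exists x; apply: mem_head.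
(* Only the vertices at inner positions [1] to [size s - 2] are deleted, which gives [size s - 2]
   arcs. *)
pose v := nth x0 s; pose D := [set C :\ v i.+1 | i : 'I_(size s - 2)].
have Ds i : i < size s -> v i \in C by move=> ilt; rewrite inE mem_nth.
have vinj i j : i < size s -> j < size s -> v i = v j -> i = j.
  by move=> il jl /eqP; rewrite nth_uniq // => /eqP.
have cardD : #|D| = size s - 2.
  rewrite card_imset ?card_ord // => i j Dij; apply/val_inj/eqP.
  have il := ltn_ord i; have jl := ltn_ord j.
  have : v i.+1 \notin C :\ v i.+1 by rewrite !inE eqxx.
  rewrite Dij in_setD1 Ds ?andbT ?negbK; last by lia.
  by move/eqP/vinj=> /(_ _ _)/eqP; rewrite eqSS; apply; lia.
have sDX : D \subset avoiding C.
  apply/subsetP => _ /imsetP[i _ ->]; have il := ltn_ord i; rewrite inE.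
  rewrite (induced_cycle_D1_connected sym_e cs); try lia.
  by rewrite subsetD1 Ds ?andbF //; lia.
rewrite -(cardsID D (avoiding C)) (setIidPr sDX) cardD addnC leq_add2l.
have nC0 : C != set0 by apply/set0Pn; exists x0; rewrite inE.
have dC : deg_ge2 e C by apply: induced_cycle_deg_ge2.
have endsD i (A : {set T}) : 0 < i -> i.+1 < size s -> ends e (C :\ v i) = A ->
    #|A| <= 2 -> A = [set v i.-1; v i.+1].
  move=> i0 il eA cA; apply/esym/eqP; rewrite eqEcard -eA ends_induced_cycle_D1 //.
  have im : i.-1 < size s by lia.
  by rewrite eA cards2 (leq_trans cA) // nth_uniq //; lia.
(* It remains to find, for each pair, a set outside [D]. *)
apply: leq_card_ends_onto => A cA.
have [[i /andP[i0 il] AE] | noti] :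
    (exists2 i, 0 < i < (size s).-1 & A = [set v i.-1; v i.+1]) \/
    (forall i, 0 < i < (size s).-1 -> A <> [set v i.-1; v i.+1]).
  have [|no] := boolP [exists i : 'I_(size s),
      (0 < i < (size s).-1) && (A == [set v i.-1; v i.+1])].
    by case/existsP=> i /andP[iP /eqP AE]; left; exists i.
  right=> i iP AE; case/existsP: no; have il : i < size s by lia.
  by exists (Ordinal il); rewrite /= iP AE eqxx.
  (* The pair belongs to a long arc in [D], so the short arc through [v i] is taken. It is induced
     because the cycle has at least four vertices: in a triangle its ends would be adjacent. *)
  pose t := [:: v i.-1; v i; v i.+1].
  have i1 : i.-1 < size s by lia.
  have i2 : i < size s by lia.
  have i3 : i.+1 < size s by lia.
  have it : induced_path e t.
    split; first by rewrite /= !inE !nth_uniq //; lia.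
    move=> y0 [|[|[|//]]] [|[|[|//]]] _ _ /=; rewrite es; lia.
  have et : ends e [set z in t] = A by rewrite ends_induced_path.
  exists [set z in t] => //; rewrite in_setD in_set; apply/and3P; split.
  - apply/imsetP => -[j _ tE]; have jl := ltn_ord j.
    have : A = [set v j; v j.+2].
      by apply: (endsD j.+1); rewrite -?tE ?et //; lia.
    (* Equal ends force the same middle vertex, but the short arc contains [v i] and the long one
       omits it. *)
    move=> AE'; have ij : i = j.+1.
      have : v i.-1 \in A by rewrite AE set21.
      have : v j \in A by rewrite AE' set21.
      rewrite {1}AE AE' !inE => /orP[] /eqP/vinj; last first.
        by move=> H /orP[] /eqP/vinj; lia.
      by lia.
    by have : v i \in [set z in t]; [rewrite !inE eqxx orbT | rewrite tE ij !inE eqxx].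
  - by apply: induced_connected_path; rewrite //= !es; lia.
  - apply: contraNN nC0 => sC; apply/eqP.
    by apply: induced_path_acyclic it sC dC.
(* For any other pair a shortest path lies outside [D], since its ends are not those of an arc in
   [D]. *)
have [S [cS eS aS]] := exists_ends cA; exists S; rewrite // in_setD in_set cS.
apply/andP; split; last by apply: contraNN nC0 => sCS; rewrite (aS _ sCS dC).
apply/imsetP => -[j _ SE]; have jl := ltn_ord j.
apply: (noti j.+1); first by lia.
by apply: endsD; rewrite -?SE //; lia.
Qed.

End Counting.

(** * Vertex listings that exhibit a tadpole *)

Definition tad_adj (i j : nat) :=
  [|| [&& i < 3, j < 3 & i != j], (2 <= i) && (i.+1 == j)
    | (2 <= j) && (j.+1 == i)].

(** The listed vertices may be only part of the graph: positions 0, 1, 2 form the triangle, and the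
    tail continues from position 2. Such a listing is extended until it exhausts the graph. *)
Definition tad_labelling (T : finType) (e : rel T) (s : seq T) :=
  uniq s /\ forall x0 i j, i < size s -> j < size s ->
    e (nth x0 s i) (nth x0 s j) = tad_adj i j.

Section TadpoleLabelling.
Variables (T : finType) (e : rel T).
Hypotheses (sym_e : symmetric e) (irr_e : irreflexive e).

Lemma induced_cycle_triangle a b c : e a b -> e b c -> e a c ->
  induced_cycle e [:: a; b; c].
Proof.
move=> ab bc ac.
have ne x y : e x y -> x != y by apply: contraTneq => ->; rewrite irr_e.
split=> //; first by rewrite /= !inE !negb_or !ne.
by move=> x0 [|[|[|//]]] [|[|[|//]]] _ _ /=; rewrite ?irr_e // sym_e.
Qed.

Lemma tad_labelling_triangle a b c : e a b -> e b c -> e a c ->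
  tad_labelling e [:: a; b; c].
Proof.
move=> ab bc ac; have [us _ _] := induced_cycle_triangle ab bc ac; split=> //.
by move=> x0 [|[|[|//]]] [|[|[|//]]] _ _ /=; rewrite ?irr_e // sym_e.
Qed.

Lemma tad_labelling_sorted s : tad_labelling e s -> sorted e s.
Proof.
case: s => // x p [_ es]; apply/(sortedP x) => i il.
by rewrite es ?(ltnW il) // /tad_adj; lia.
Qed.

Lemma tad_labelling_rcons s w : tad_labelling e s -> 2 < size s -> w \notin s ->
  (forall x0 i, i < size s -> e w (nth x0 s i) = (i.+1 == size s)) ->
  tad_labelling e (rcons s w).
Proof.
move=> [us es] s3 ws ew; split; first by rewrite rcons_uniq ws.
move=> x0 i j; rewrite size_rcons !nth_rcons => il jl.
case: (ltngtP i (size s)) => [ilt | | iE]; last 1 first.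
- case: (ltngtP j (size s)) => [jlt | | jE]; try lia.
    by rewrite ew // /tad_adj; lia.
  by rewrite irr_e /tad_adj; lia.
- case: (ltngtP j (size s)) => [jlt | | jE]; try lia; first exact: es.
  by rewrite sym_e ew // /tad_adj; lia.
by lia.
Qed.

Lemma tad_labelling_iso s : tad_labelling e s -> size s = #|T| ->
  graph_iso e (tadpole3 #|T|).
Proof.
move=> [us es] sz.
have all_s x : x \in s.
  have /subset_cardP/(_ (subset_predT _))-> // : #|s| = #|T|.
  by rewrite (card_uniqP us).
have lt x : index x s < #|T| by rewrite -sz index_mem.
exists (fun x => Ordinal (lt x)); split.
  apply: inj_card_bij; last by rewrite card_ord.
  by move=> x y [] /index_inj; apply.
move=> x y; rewrite -{1}(nth_index x (all_s x)) -{1}(nth_index x (all_s y)).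
by rewrite es ?index_mem.
Qed.

End TadpoleLabelling.

(** * Structure of the graph when both counts are tight *)

Section Extremal.
Variables (T : finType) (e : rel T).
Hypotheses (sym_e : symmetric e) (irr_e : irreflexive e) (con_e : connected_graph e).
Variable C : {set T}.
Hypotheses (con_C : induced_connected e C) (deg_C : deg_ge2 e C).
Hypotheses (clique_C : {in C &, forall x y, x != y -> e x y}) (card_C : #|C| = 3).
Hypothesis few_containing : #|containing e C| <= #|T|.+1 - 3.
Hypothesis few_avoiding : #|avoiding e C| <= #|T| + 'C(#|T|, 2).

(** Two neighbours of [w] in the clique [C] would form with [w] a triangle other than [C]: a
    connected set avoiding [C] and without ends. *)
Lemma outside_vertex_pendant w : w \notin C ->
  {in C &, forall x y, e w x -> e w y -> x = y}.
Proof.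
move=> wC x y xC yC ewx ewy; apply/eqP; apply/negPn/negP => xy.
have cyc : induced_cycle e [:: w; x; y].
  by apply: induced_cycle_triangle => //; apply: clique_C.
have C0 : C != set0 by rewrite -card_gt0 card_C.
have : [set z in [:: w; x; y]] \in avoiding e C.
  rewrite inE induced_cycle_connected //=; apply/negP => sC.
  have /subset_leq_card : C \subset [set x; y].
    apply/subsetP => z zC; have := subsetP sC z zC; rewrite !inE.
    by case/predU1P => // zw; rewrite -zw zC in wC.
  by rewrite card_C cards2; case: (_ != _).
move/(avoiding_ends_neq0 sym_e irr_e con_e C0 deg_C few_avoiding)/set0Pn => [z].
rewrite inE => /andP[zS]; apply/negP; rewrite -ltnNge.
exact: (induced_cycle_deg_ge2 cyc).
Qed.

Lemma tad_labelling_base : 3 < #|T| -> exists s,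
  [/\ tad_labelling e s, size s = 4 & C = [set z in take 3 s]].
Proof.
move=> T4; have prC : C \proper [set: T].
  by rewrite properEcard subsetT cardsT card_C.
have C0 : C != set0 by rewrite -card_gt0 card_C.
have [c [w [cC _ wC ecw]]] := induced_connected_edge_out con_e prC C0.
have /cards2P[a [b [ab abE]]] : #|C :\ c| == 2.
  by have := cardsD1 c C; rewrite cC card_C; lia.
have /setD1P[ac aC] : a \in C :\ c by rewrite abE set21.
have /setD1P[bc bC] : b \in C :\ c by rewrite abE set22.
have CE : C = [set z in [:: a; b; c]].
  rewrite -(setD1K cC) abE; apply/setP => z; rewrite !inE.
  by case: (z == a); case: (z == b); case: (z == c).
have tri : tad_labelling e [:: a; b; c].
  by apply: tad_labelling_triangle => //; apply: clique_C.
(* The attaching vertex [c] takes position 2, where the tail starts. *)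
exists [:: a; b; c; w]; split=> //.
apply: (tad_labelling_rcons sym_e irr_e tri) => //.
  by move: wC; rewrite CE inE.
have ewc : e w c by rewrite sym_e.
have non z : z \in C -> z != c -> e w z = false.
  move=> zC; apply: contraNF => ewz; apply/eqP.
  exact: (outside_vertex_pendant wC).
by move=> x0 [|[|[|//]]] _ /=; [apply: non | apply: non | apply: ewc].
Qed.

(** A new vertex attached before the last position could replace the last vertex, giving a second
    connected set of the same size containing [C]. *)
Lemma tad_labelling_step s : tad_labelling e s -> 3 < size s ->
  C = [set z in take 3 s] -> size s < #|T| ->
  exists w, tad_labelling e (rcons s w).
Proof.
move=> ts s4 CE sT; have [us es] := ts; have srt := tad_labelling_sorted ts.
have cardS (p : seq T) : uniq p -> #|[set z in p]| = size p.
  by move=> up; rewrite cardsE; apply/card_uniqP.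
have cS : induced_connected e [set z in s].
  by apply: induced_connected_sorted => //; case: (s) s4.
have [x [w [xs _ ws exw]]] : exists x y,
    [/\ x \in [set z in s], y \in [set: T], y \notin [set z in s] & e x y].
  apply: induced_connected_edge_out con_e _ _; last by case/andP: cS.
  by rewrite properEcard subsetT cardsT cardS.
rewrite inE in ws; exists w; apply: tad_labelling_rcons => //; first exact: ltnW.
(* Since [3 < size s], dropping the last vertex keeps all of [C]. *)
pose t := take (size s).-1 s.
have szt : size t = (size s).-1 by rewrite size_takel // leq_pred.
have key x0 i : i < size s -> e w (nth x0 s i) -> i.+1 = size s.
  move=> il ewi; apply/eqP; apply/negPn/negP => ni.
  have it : i < (size s).-1 by lia.
  have ct : induced_connected e [set z in t].
    apply: induced_connected_sorted => //; first exact: take_sorted.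
    by rewrite -size_eq0 szt; lia.
  have wt : w \notin t by apply: contra ws; apply: mem_take.
  suff /setP/(_ w) : [set z in s] = w |: [set z in t].
    by rewrite !inE eqxx (negbTE ws).
  apply: (containing_inj sym_e con_e con_C); rewrite ?card_C //.
  - by rewrite inE cS CE; apply/subsetP => z; rewrite !inE; apply: mem_take.
  - rewrite inE (induced_connectedU1 sym_e ct _ ewi) /=.
      rewrite CE; apply/subsetP => z; rewrite !inE => z3; apply/orP; right.
      suff E : take 3 s = take 3 t by rewrite E in z3; apply: mem_take z3.
      by rewrite take_takel //; lia.
    by rewrite inE -(nth_take x0 it) mem_nth // szt.
  - by rewrite cardsU1 inE wt !cardS ?take_uniq // szt; lia.
have [k kl kx] : exists2 k, k < size s & nth x s k = x.
  by apply/nthP; rewrite inE in xs.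
move=> x0 i il; apply/idP/eqP; first exact: key.
(* The neighbour [x] through which [w] was found must itself be the last vertex. *)
move=> iE; have kE : k.+1 = size s by apply: (key x) => //; rewrite kx sym_e.
have ->: i = k by lia.
by rewrite (set_nth_default x) // kx sym_e.
Qed.

Lemma extremal_iso : graph_iso e (tadpole3 #|T|).
Proof.
have T3 : 3 <= #|T| by rewrite -card_C max_card.
case: (ltngtP 3 #|T|) T3 => // [T4 | TE] _; last first.
  have CT : C = [set: T] by apply/eqP; rewrite eqEcard subsetT cardsT card_C -TE.
  have /cards2P[a [b [ab abE]]] : #|C :\ (enum_val (cast_ord TE ord0))| == 2.
    have := cardsD1 (enum_val (cast_ord TE ord0)) C.
    by rewrite {2}CT inE card_C; lia.
  set c := enum_val _ in abE.
  have /setD1P[ac _] : a \in C :\ c by rewrite abE set21.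
  have /setD1P[bc _] : b \in C :\ c by rewrite abE set22.
  apply: (@tad_labelling_iso _ _ [:: a; b; c]); last by rewrite -TE.
  by apply: tad_labelling_triangle => //; apply: clique_C; rewrite // CT inE.
suff [s [ts sz _]] : exists s,
    [/\ tad_labelling e s, size s = #|T| & C = [set z in take 3 s]].
  exact: tad_labelling_iso ts sz.
suff H k : k <= #|T| - 4 -> exists s,
    [/\ tad_labelling e s, size s = k + 4 & C = [set z in take 3 s]].
  by have := H _ (leqnn _); rewrite subnK.
elim: k => [|k IHk] lek; first exact: tad_labelling_base.
have [s [ts sz CE]] := IHk (ltnW lek).
have [||w tw] := tad_labelling_step ts _ CE; rewrite ?sz; try lia.
exists (rcons s w); split=> //; first by rewrite size_rcons sz.
by rewrite CE -cats1 takel_cat // sz; lia.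
Qed.

End Extremal.

(** * Upper bound for the tadpole *)

Section TadpoleCount.
Variable n : nat.
Hypothesis n3 : 3 <= n.
Local Notation e := (tadpole3 n).

Lemma tadpole3E (x y : 'I_n) : e x y = tad_adj x y.
Proof. by []. Qed.

(** For [z >= 2], every edge from a label below [z] to a label not below [z] ends at [z]. *)
Lemma tadpole_no_gap (S : {set 'I_n}) (x y z : 'I_n) : induced_connected e S ->
  x \in S -> y \in S -> 2 <= z -> x < z < y -> z \in S.
Proof.
move=> cS xS yS z2 /andP[xz zy]; apply/negPn/negP => zS.
pose A := [set i in S | i < z].
have prA : A \proper S.
  apply/properP; split; first by apply/subsetP => i; rewrite inE => /andP[].
  by exists y; rewrite // inE yS; lia.
have A0 : A != set0 by apply/set0Pn; exists x; rewrite inE xS.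
have [i [j [iA jS jA]]] := induced_connected_edge_out cS prA A0.
have jz : j != z by apply: contraNneq zS => <-.
have jz' : (j : nat) != z by [].
by move: iA jA; rewrite !inE jS tadpole3E /tad_adj; lia.
Qed.

(** For [p.1 <= p.2], the shortest path between the two labels; [2 <= z] keeps vertex 1 off the
    paths that start at vertex 0. *)
Definition tad_path (p : 'I_n * 'I_n) : {set 'I_n} :=
  [set z | [|| z == p.1, z == p.2 | [&& p.1 < z, z < p.2 & 2 <= z]]].

Definition tad_full (b : 'I_n) : {set 'I_n} := [set z : 'I_n | z <= b].

(** A connected set is determined by its least label [a], its greatest label [b], and whether it
    contains the whole triangle. *)
Lemma tadpole_connected_sets :
  [set S | induced_connected e S] \subset
    tad_path @: [set p : 'I_n * 'I_n | p.1 <= p.2] :|: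
    tad_full @: [set b : 'I_n | 2 <= b].
Proof.
apply/subsetP => S; rewrite inE => cS.
have /andP[/set0Pn[c cinS] _] := cS.
case: (arg_minnP (fun i : 'I_n => i : nat) cinS) => a aS' mina; have aS : a \in S := aS'.
case: (arg_maxnP (fun i : 'I_n => i : nat) cinS) => b bS' maxb; have bS : b \in S := bS'.
have lt0n : 0 < n by lia.
have lt1n : 1 < n by lia.
pose o0 := Ordinal lt0n; pose o1 := Ordinal lt1n.
have [/and3P[S0 S1 b2] | notfull] := boolP [&& o0 \in S, o1 \in S & 2 <= b].
  apply/setUP; right; apply/imsetP; exists b; rewrite ?inE //.
  apply/setP => z; rewrite inE; apply/idP/idP => [/maxb // | zb].
  have [z0 | z0] := eqVneq (z : nat) 0; first by rewrite (_ : z = o0) //; apply: val_inj.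
  have [z1 | z1] := eqVneq (z : nat) 1; first by rewrite (_ : z = o1) //; apply: val_inj.
  have [/val_inj-> // | zb'] := eqVneq (z : nat) b.
  by apply: (tadpole_no_gap cS S0 bS) => /=; lia.
apply/setUP; left; apply/imsetP; exists (a, b); first by rewrite inE; apply: mina.
apply/setP => z; rewrite inE /=; apply/idP/or3P => [zS | [/eqP-> | /eqP-> | /and3P[az zb z2]]] //.
  have [_ | za] := eqVneq z a; first by constructor 1.
  have [_ | zb] := eqVneq z b; first by constructor 2.
  constructor 3; have := mina z zS; have := maxb z zS; move: za zb; rewrite -!val_eqE /=.
  (* A label strictly between [a] and [b] and below 2 would be 1, with [a = 0] and [b >= 2]: the
     case already treated. *)
  move=> za zb zleb alez; suff z2 : 2 <= z by lia.
  rewrite leqNgt; apply: contra notfull => z2.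
  have z1 : (z : nat) = 1 by lia.
  have a0 : (a : nat) = 0 by lia.
  have <- : a = o0 by apply: val_inj.
  have <- : z = o1 by apply: val_inj.
  by rewrite aS zS; lia.
by apply: (tadpole_no_gap cS aS bS) => //; rewrite az.
Qed.

(** The set and its mirror image have equal size, cover all [n ^ 2] pairs and meet in the
    diagonal. *)
Lemma card_ord_pairs_le :
  2 * #|[set p : 'I_n * 'I_n | p.1 <= p.2]| = n ^ 2 + n.
Proof.
pose A := [set p : 'I_n * 'I_n | p.1 <= p.2].
pose B := [set p : 'I_n * 'I_n | p.2 <= p.1].
have AB : #|B| = #|A|.
  pose swap (p : 'I_n * 'I_n) := (p.2, p.1).
  have swapK : involutive swap by case.
  rewrite -(card_imset A (inv_inj swapK)); apply: eq_card => p.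
  by rewrite -{2}(swapK p) mem_imset ?inE //; apply: inv_inj.
rewrite mul2n -addnn -{2}AB -cardsUI; congr (_ + _).
  rewrite (_ : _ :|: _ = setT) ?cardsT ?card_prod ?card_ord ?mulnn //.
  by apply/setP => p; rewrite !inE leq_total.
rewrite -[RHS]card_ord -(card_imset _ (_ : injective (fun x : 'I_n => (x, x)))).
  apply: eq_card => -[x y]; rewrite !inE -eqn_leq.
  by apply/eqP/imsetP => [/val_inj/= <- | [z _ [-> ->]]] //; exists x.
by move=> x y [].
Qed.

Lemma card_ord_ge2 : #|[set b : 'I_n | 2 <= b]| = n - 2.
Proof.
have := cardsC [set b : 'I_n | b < 2]; rewrite card_ord.
have -> : ~: [set b : 'I_n | b < 2] = [set b : 'I_n | 2 <= b].
  by apply/setP => b; rewrite !inE -leqNgt.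
suff -> : #|[set b : 'I_n | b < 2]| = 2 by lia.
have le2n : 2 <= n by lia.
have inj : injective (widen_ord le2n) by move=> a b [] /val_inj.
rewrite -[RHS]card_ord -[RHS](card_imset _ inj).
apply: eq_card => b; rewrite inE; apply/idP/imsetP => [b2 | [c _ ->]]; last exact: (ltn_ord c).
by exists (Ordinal b2) => //; apply: val_inj.
Qed.

Lemma Nconn_tadpole3_le : 2 * Nconn e <= n ^ 2 + 3 * n - 4.
Proof.
have le1 := leq_imset_card tad_path [set p : 'I_n * 'I_n | p.1 <= p.2].
have le2 := leq_imset_card tad_full [set b : 'I_n | 2 <= b].
rewrite card_ord_ge2 in le2.
have le : Nconn e <= _ := leq_trans (subset_leq_card tadpole_connected_sets)
  (leq_trans (leq_card_setU _ _) (leq_add le1 le2)).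
move: le; rewrite -(leq_pmul2l (isT : 0 < 2)) mulnDr card_ord_pairs_le => le.
by apply: leq_trans le _; lia.
Qed.

End TadpoleCount.

(** * Transport along an isomorphism and the final count *)

Lemma Nconn_iso_le (T U : finType) (e : rel T) (f : rel U) :
  graph_iso e f -> Nconn e <= Nconn f.
Proof.
case=> g [bij_g ef]; have inj_g := bij_inj bij_g.
rewrite /Nconn -[X in X <= _](card_imset _ (imset_inj inj_g)).
apply/subset_leq_card/subsetP => _ /imsetP[S + ->]; rewrite !inE.
case/andP=> /set0Pn[x xS] /forall_inP cS; apply/andP; split.
  by apply/set0Pn; exists (g x); apply: imset_f.
apply/forall_inP => _ /imsetP[a aS ->]; apply/forall_inP => _ /imsetP[b bS ->].
have /forall_inP/(_ b bS)/connectP[p ep ->] := cS a aS.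
apply/connectP; exists (map g p); last by rewrite last_map.
apply: homo_path ep => u v /and3P[uS vS euv].
by apply/and3P; split; rewrite ?imset_f // -ef.
Qed.

Theorem mainTheorem7 (T : finType) (e : rel T) :
  unicyclic e -> 3 <= #|T| ->
  (#|T| ^ 2 + 3 * #|T| - 4 <= 2 * Nconn e) /\
  (2 * Nconn e = #|T| ^ 2 + 3 * #|T| - 4 <-> graph_iso e (tadpole3 #|T|)).
Proof.
case=> [[sym_e irr_e] con_e [C0 [/(exists_induced_cycle sym_e irr_e)[s cs] _]]] T3.
have bin2E : 2 * 'C(#|T|, 2) = (#|T| - 1) * #|T| by rewrite mul_bin_left bin1.
have T2 : #|T| ^ 2 = #|T| * #|T| by rewrite mulnn.
have [us s3 es] := cs; set C := [set z in s].
have con_C : induced_connected e C by apply: induced_cycle_connected.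
have deg_C : deg_ge2 e C by apply: induced_cycle_deg_ge2.
have card_C : #|C| = size s by apply: card_induced_cycle cs.
have C0' : C != set0 by case/andP: con_C.
have sT : size s <= #|T| by rewrite -card_C max_card.
have NE := Nconn_split e C.
have leY := card_containing sym_e con_e con_C.
have leX := card_avoiding sym_e irr_e con_e C0' deg_C.
(* The boolean adds one for a long cycle, so this gives both the bound and its strictness. For
   [size s > 3] the extra [size s - 2] sets more than make up for the fewer sets containing the
   cycle. *)
have lower : #|T| ^ 2 + 3 * #|T| - 4 + (3 < size s) <= 2 * Nconn e.
  case: ltnP => s4; last by nia.
  by have := card_avoiding_long sym_e irr_e con_e cs s4; rewrite -/C; nia.
have lower0 := leq_trans (leq_addr _ _) lower; split=> //.
split=> [eqN | iso]; last first.
  apply/eqP; rewrite eqn_leq lower0 andbT.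
  apply: leq_trans (Nconn_tadpole3_le T3).
  by rewrite leq_mul2l Nconn_iso_le.
have s3' : size s = 3 by lia.
(* With [size s = 3], equality in the sum makes both [leX] and [leY] equalities. *)
apply: (@extremal_iso _ _ sym_e irr_e con_e C) => //; try by nia.
move=> x y; rewrite !inE => /(nthP x)[i il <-] /(nthP x)[j jl <-].
rewrite nth_uniq // es //; rewrite s3' in il jl *.
by case: i il => [|[|[|//]]]; case: j jl => [|[|[|//]]].
Qed.
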